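(* Let $\mathcal{I}_{\mathcal{G}}$ be an unknown self-reducible sampler and $\mathcal{I}_{\mathcal{W}}$ a known self-reducible sampler with output range $\{0,1\}^n$, $\psi$ an input, $\varepsilon\in(0,1)$ a closeness parameter, $\eta\in(0,1)$ a farness parameter with $\eta>\varepsilon$, and $\delta\in(0,1)$ a confidence parameter. There exists an $(\varepsilon,\eta,\delta)$-identity tester for self-reducible samplers (namely $\mathsf{CubeProbeTester}$) that takes $\widetilde{\mathcal{O}}\big(n^2/(\eta-\varepsilon)^4\big)$ samples.
   Context: A sampler $\mathcal{I}$ is a randomized algorithm that on input $\psi\in\{0,1\}^m$ outputs an element of $\{0,1\}^n$; $\mathcal{D}^{\mathcal{I},\psi}$ denotes its output distribution. A sampler $\mathcal{I}_{\mathcal{W}}$ is known if $\mathcal{D}^{\mathcal{I}_{\mathcal{W}},\psi}(x)$ is explicitly available for all $\psi,x$. A sampler $\mathcal{I}$ is self-reducible if for every input $\psi$, every $i$ and every $b_1\dots b_i\in\{0,1\}^i$ there is an input $\widehat\psi=\mathsf{SubCond}(\psi,b_1\dots b_i)$ with $\mathcal{D}^{\mathcal{I},\widehat\psi}$ equal to $\mathcal{D}^{\mathcal{I},\psi}$ conditioned on $x_1=b_1,\dots,x_i=b_i$ (uniform on the subcube if the event has probability $0$). $\mathsf{d}^{\psi}_{\mathrm{TV}}(\mathcal{I}_{\mathcal{G}},\mathcal{I}_{\mathcal{W}})=\max_{A\subseteq\{0,1\}^n}\{\mathcal{D}^{\mathcal{I}_{\mathcal{G}},\psi}(A)-\mathcal{D}^{\mathcal{I}_{\mathcal{W}},\psi}(A)\}$.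 $\mathcal{I}_{\mathcal{G}}$ is $\varepsilon$-close to $\mathcal{I}_{\mathcal{W}}$ on $\psi$ if this distance is $\le\varepsilon$ and $\eta$-far if it is $\ge\eta$. An $(\varepsilon,\eta,\delta)$-identity tester, given $\mathcal{I}_{\mathcal{G}},\mathcal{I}_{\mathcal{W}},\psi,\varepsilon,\eta,\delta$, with probability at least $1-\delta$ outputs ACCEPT if $\mathcal{I}_{\mathcal{G}}$ is $\varepsilon$-close to $\mathcal{I}_{\mathcal{W}}$ on $\psi$ and outputs REJECT if $\mathcal{I}_{\mathcal{G}}$ is $\eta$-far from $\mathcal{I}_{\mathcal{W}}$ on $\psi$. Samples are samples drawn from $\mathcal{I}_{\mathcal{G}}$ (on any inputs); $\widetilde{\mathcal{O}}$ hides polylogarithmic factors. *)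

(* Defs.v *)
From HB Require Import structures.
From mathcomp Require Import all_boot all_order all_algebra.
From mathcomp Require Import reals exp.

Set Implicit Arguments.
Unset Strict Implicit.
Unset Printing Implicit Defensive.

Import Order.TTheory GRing.Theory Num.Theory.
Local Open Scope ring_scope.

Record fdist (R : realType) (T : finType) := FDist {
  pmf :> T -> R;
  pmf_ge0 : forall x, 0 <= pmf x;
  pmf_sum1 : \sum_x pmf x = 1 }.

Definition Pr (R : realType) (T : finType) (D : fdist R T) (A : {set T}) : R :=
  \sum_(x in A) D x.

(* A randomized algorithm used only as a source of independent samples is
   identified with the family of its output distributions. *)
Definition sampler (R : realType) (n m : nat) :=
  m.-tuple bool -> fdist R (n.-tuple bool).

Definition subcube (n : nat) (b : seq bool) : {set n.-tuple bool} :=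
  [set x : n.-tuple bool | prefix b x].

Definition cond_subcube (R : realType) (n : nat)
    (D : fdist R (n.-tuple bool)) (b : seq bool) (x : n.-tuple bool) : R :=
  if x \notin subcube n b then 0
  else if Pr D (subcube n b) == 0 then #|subcube n b|%:R^-1
  else D x / Pr D (subcube n b).

Record sr_sampler (R : realType) (n m : nat) := SRSampler {
  sr_dist :> sampler R n m;
  SubCond : m.-tuple bool -> seq bool -> m.-tuple bool;
  SubCondP : forall (psi : m.-tuple bool) (b : seq bool) (x : n.-tuple bool),
    (size b <= n)%N ->
    sr_dist (SubCond psi b) x = cond_subcube (sr_dist psi) b x }.

(* The neutral element 0 is the value at A = set0, so this is the maximum. *)
Definition dTV (R : realType) (n m : nat) (G W : sampler R n m)
    (psi : m.-tuple bool) : R :=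
  \big[Num.max/0]_(A : {set n.-tuple bool}) (Pr (G psi) A - Pr (W psi) A).

Definition close (R : realType) (n m : nat) (eps : R) (G W : sampler R n m)
    (psi : m.-tuple bool) : Prop := dTV G W psi <= eps.

Definition far (R : realType) (n m : nat) (eta : R) (G W : sampler R n m)
    (psi : m.-tuple bool) : Prop := eta <= dTV G W psi.

Inductive verdict := ACCEPT | REJECT.

(* Adaptive randomized procedures with black-box access to an unknown
   self-reducible sampler: they may flip a fair coin, draw a sample from the
   unknown sampler on any input, or evaluate its SubCond map; only draws are
   counted as samples. *)
Inductive procedure (n m : nat) : Type :=
| Output of verdict
| Flip of (bool -> procedure n m)
| Draw of m.-tuple bool & (n.-tuple bool -> procedure n m)
| AskSubCond of m.-tuple bool & seq bool & (m.-tuple bool -> procedure n m).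

Definition verdict_eqb (u v : verdict) : bool :=
  match u, v with
  | ACCEPT, ACCEPT | REJECT, REJECT => true
  | _, _ => false
  end.

(* Probability that p outputs v when run with access to G; fresh draws and coin
   flips are independent. *)
Fixpoint prob_output (R : realType) (n m : nat) (G : sr_sampler R n m)
    (v : verdict) (p : procedure n m) {struct p} : R :=
  match p with
  | Output u => (verdict_eqb u v)%:R
  | Flip k => (prob_output G v (k true) + prob_output G v (k false)) / 2
  | Draw phi k => \sum_(x : n.-tuple bool) sr_dist G phi x * prob_output G v (k x)
  | AskSubCond phi b k => prob_output G v (k (SubCond G phi b))
  end.

(* Worst case over coin flips and over all answers. *)
Fixpoint num_samples (n m : nat) (p : procedure n m) : nat :=
  match p with
  | Output _ => 0%N
  | Flip k => maxn (num_samples (k true)) (num_samples (k false))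
  | Draw _ k => ((\max_(x : n.-tuple bool) num_samples (k x)).+1)%N
  | AskSubCond _ _ k => (\max_(phi : m.-tuple bool) num_samples (k phi))%N
  end.

(* The known sampler W is an explicit argument; the unknown sampler is not, and
   is only reachable through the oracle nodes of the resulting procedure. *)
Definition tester (R : realType) (n m : nat) :=
  sr_sampler R n m -> m.-tuple bool -> procedure n m.

Definition identity_tester (R : realType) (n m : nat) (eps eta delta : R)
    (T : tester R n m) : Prop :=
  forall (G W : sr_sampler R n m) (psi : m.-tuple bool),
    (close eps G W psi -> 1 - delta <= prob_output G ACCEPT (T W psi)) /\
    (far eta G W psi -> 1 - delta <= prob_output G REJECT (T W psi)).

(* Main.v *)
Require Import Defs.
From HB Require Import structures.
From mathcomp Require Import all_boot all_order all_algebra.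
From mathcomp Require Import reals sequences exp.
From mathcomp Require Import ring lra.

Set Implicit Arguments.
Unset Strict Implicit.
Unset Printing Implicit Defensive.

Import Order.TTheory GRing.Theory Num.Theory.
Local Open Scope ring_scope.

(** With P = G psi and Q = W psi, the distance is the mean of max(0, 1 - Q x / P x)
    over x ~ P.  The unknown P x is estimated by the product, over the
    coordinates i, of the empirical frequency of the bit x_i among N draws from
    P conditioned on x_1 .. x_(i-1).  A conditional bit probability p is
    estimated with relative variance at most 1 / (p N); this is unbounded in p,
    but averaging over the bit x_i itself cancels the factor 1 / p, so that the
    chi-square error of the product, averaged over x ~ P, is at most
    (1 + 2/N)^n - 1 whatever P is.  Hence N = O(n / gam^2) nonadaptive probes
    per coordinate, gam = eta - eps, make the bias at most gam / 4, and a
    Chernoff bound over O(ln (1/delta) / gam^2) independent trials with scores in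
    [0, 1] separates the two cases. *)

Lemma eqr_le (R : realType) (x y : R) : x = y -> x <= y.
Proof. by move->. Qed.

(** * Programs with a general result type, and their expectations *)

Inductive prog (n m : nat) (A : Type) : Type :=
| Ret of A
| DrawP of m.-tuple bool & (n.-tuple bool -> prog n m A)
| AskP of m.-tuple bool & seq bool & (m.-tuple bool -> prog n m A).

Arguments Ret {n m A}.
Arguments DrawP {n m A}.
Arguments AskP {n m A}.

Fixpoint bind n m A B (p : prog n m A) (q : A -> prog n m B) : prog n m B :=
  match p with
  | Ret a => q a
  | DrawP phi k => DrawP phi (fun x => bind (k x) q)
  | AskP phi b k => AskP phi b (fun x => bind (k x) q)
  end.

(** Verdicts alone cannot be sequenced: intermediate results live in [prog], and only a finished
    program becomes a [procedure]. *)
Fixpoint compile n m (p : prog n m verdict) : procedure n m :=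
  match p with
  | Ret v => Output n m v
  | DrawP phi k => Draw phi (fun x => compile (k x))
  | AskP phi b k => AskSubCond phi b (fun x => compile (k x))
  end.

Fixpoint draws n m A (p : prog n m A) : nat :=
  match p with
  | Ret _ => 0
  | DrawP _ k => (\max_(x : n.-tuple bool) draws (k x)).+1
  | AskP _ _ k => \max_(phi : m.-tuple bool) draws (k phi)
  end%N.

Fixpoint expect (R : realType) n m A (G : sr_sampler R n m) (p : prog n m A)
    (f : A -> R) : R :=
  match p with
  | Ret a => f a
  | DrawP phi k => \sum_(x : n.-tuple bool) sr_dist G phi x * expect G (k x) f
  | AskP phi b k => expect G (k (SubCond G phi b)) f
  end.

Lemma num_samples_compile n m (p : prog n m verdict) :
  num_samples (compile p) = draws p.
Proof.
elim: p => [v|phi k IH|phi b k IH] //=.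
- by congr _.+1; apply: eq_bigr.
- exact: eq_bigr.
Qed.

Lemma draws_bind n m A B (p : prog n m A) (q : A -> prog n m B) d :
  (forall a, (draws (q a) <= d)%N) -> (draws (bind p q) <= draws p + d)%N.
Proof.
move=> hq; elim: p => [v|phi k IH|phi b k IH] //=.
- rewrite addSn ltnS; apply/bigmax_leqP => x _.
  by apply: leq_trans (IH x) _; rewrite leq_add2r leq_bigmax.
- apply/bigmax_leqP => x _.
  by apply: leq_trans (IH x) _; rewrite leq_add2r leq_bigmax.
Qed.

Section Expectation.
Variables (R : realType) (n m : nat) (G : sr_sampler R n m).

Lemma prob_output_compile (p : prog n m verdict) v :
  prob_output G v (compile p) = expect G p (fun u => (verdict_eqb u v)%:R).
Proof.
elim: p => [u|phi k IH|phi b k IH] //=.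
by apply: eq_bigr => x _; rewrite IH.
Qed.

Lemma expect_bind A B (p : prog n m A) (q : A -> prog n m B) f :
  expect G (bind p q) f = expect G p (fun a => expect G (q a) f).
Proof.
elim: p => [u|phi k IH|phi b k IH] //=.
by apply: eq_bigr => x _; rewrite IH.
Qed.

Lemma expect_le A (p : prog n m A) f g :
  (forall a, f a <= g a) -> expect G p f <= expect G p g.
Proof.
move=> fg; elim: p => [u|phi k IH|phi b k IH] //=.
by apply: ler_sum => x _; apply: ler_wpM2l => //; apply: pmf_ge0.
Qed.

Lemma eq_expect A (p : prog n m A) f g : f =1 g -> expect G p f = expect G p g.
Proof. by move=> fg; apply/le_anti; rewrite !expect_le // => a; rewrite fg. Qed.

Lemma expect_cst A (p : prog n m A) c : expect G p (fun=> c) = c.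
Proof.
elim: p => [u|phi k IH|phi b k IH] //=.
under eq_bigr do rewrite IH.
by rewrite -mulr_suml pmf_sum1 mul1r.
Qed.

Lemma expectZ A (p : prog n m A) c f :
  expect G p (fun a => c * f a) = c * expect G p f.
Proof.
elim: p => [u|phi k IH|phi b k IH] //=.
by rewrite mulr_sumr; apply: eq_bigr => x _; rewrite IH; ring.
Qed.

Lemma expectD A (p : prog n m A) f g :
  expect G p (fun a => f a + g a) = expect G p f + expect G p g.
Proof.
elim: p => [u|phi k IH|phi b k IH] //=.
by rewrite -big_split; apply: eq_bigr => x _; rewrite IH mulrDr.
Qed.

(** Jensen's inequality for the absolute value, from monotonicity applied to both signs of
    [f a - c]. *)
Lemma expect_dist A (p : prog n m A) f c e :
  expect G p (fun a => `|f a - c|) <= e -> `|expect G p f - c| <= e.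
Proof.
move=> h; rewrite -(expect_cst p c) -[- _]mulN1r -expectZ -expectD.
apply: le_trans h; rewrite ler_norml; apply/andP; split.
  rewrite -[leLHS]mulN1r -expectZ; apply: expect_le => a.
  by have := ler_norm (- (f a - c)); rewrite normrN; lra.
by apply: expect_le => a; have := ler_norm (f a - c); lra.
Qed.

End Expectation.

(** * Empirical counts over independent draws *)

Section Hits.
Variables (n m : nat).

Fixpoint hits (phi : m.-tuple bool) (a : pred (n.-tuple bool)) N : prog n m nat :=
  if N is N'.+1 then
    DrawP phi (fun y => bind (hits phi a N') (fun c => Ret (c + a y)%N))
  else Ret 0%N.

Lemma draws_hits phi a N : (draws (hits phi a N) <= N)%N.
Proof.
elim: N => //= N IH; rewrite ltnS; apply/bigmax_leqP => x _.
apply: leq_trans (draws_bind _ (d := 0) _) _ => //.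
by rewrite addn0.
Qed.

Variables (R : realType) (G : sr_sampler R n m).

Definition freq phi (a : pred (n.-tuple bool)) : R := \sum_y sr_dist G phi y * (a y)%:R.

Lemma freq_ge0 phi a : 0 <= freq phi a.
Proof. by apply: sumr_ge0 => y _; rewrite mulr_ge0 // pmf_ge0. Qed.

Lemma expect_hits phi a N :
  expect G (hits phi a N) (fun c => c%:R) = N%:R * freq phi a.
Proof.
elim: N => [|N IH] /=; first by rewrite mul0r.
have step y : expect G (bind (hits phi a N) (fun c => Ret (c + a y)%N))
   (fun c => c%:R) = N%:R * freq phi a + (a y)%:R.
  rewrite expect_bind /=.
  under eq_expect do rewrite natrD.
  by rewrite expectD expect_cst IH.
under eq_bigr do rewrite step mulrDr.
rewrite big_split /= -mulr_suml pmf_sum1 -/(freq phi a) -natr1; ring.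
Qed.

(** The count is binomial with second moment [(N^2 - N) p^2 + N p]; dropping [- N p^2] lets the
    bound factor as [N^2 p (p + 1/N)]. *)
Lemma expect_hits2 phi a N :
  expect G (hits phi a N) (fun c => c%:R ^+ 2)
    <= N%:R ^+ 2 * freq phi a ^+ 2 + N%:R * freq phi a.
Proof.
suff -> : expect G (hits phi a N) (fun c => c%:R ^+ 2)
  = (N%:R ^+ 2 - N%:R) * freq phi a ^+ 2 + N%:R * freq phi a.
  rewrite lerD2r; apply: ler_wpM2r; first exact: sqr_ge0.
  by rewrite gerBl ler0n.
elim: N => [|N IH] /=; first by rewrite !mul0r expr0n /= subrr mul0r addr0.
have step y : expect G (bind (hits phi a N) (fun c => Ret (c + a y)%N))
   (fun c => c%:R ^+ 2) = ((N%:R ^+ 2 - N%:R) * freq phi a ^+ 2 + N%:R * freq phi a)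
     + (2 * N%:R * freq phi a + 1) * (a y)%:R.
  rewrite expect_bind /=.
  (* The cross term is rewritten with the mean of the count, so that both sides are expectations
     over the same program and the square expands pointwise. *)
  have -> : (2 * N%:R * freq phi a + 1) * (a y)%:R =
    2 * (a y)%:R * expect G (hits phi a N) (fun c => c%:R) + (a y)%:R ^+ 2.
    by rewrite expect_hits; case: (a y) => /=; ring.
  rewrite -IH -expectZ -[_ ^+ 2 in RHS](expect_cst G (hits phi a N)) -!expectD.
  by apply: eq_expect => c; rewrite natrD; ring.
under eq_bigr => y _ do rewrite step mulrDr
  [X in _ + X](mulrCA (sr_dist G phi y) (2 * N%:R * freq phi a + 1) (a y)%:R).
rewrite big_split /= -mulr_suml -mulr_sumr pmf_sum1 -/(freq phi a) -natr1; ring.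
Qed.

End Hits.

(** * Products along a bit string *)

Section Chain.
Variable R : realType.

(** [pre] carries the bits already read, so that each factor may depend on the whole prefix, as a
    conditional probability does. *)
Fixpoint chain (q : seq bool -> bool -> R) (pre s : seq bool) : R :=
  if s is c :: s' then q pre c * chain q (rcons pre c) s' else 1.

Lemma chain_ge0 q pre s : (forall b c, 0 <= q b c) -> 0 <= chain q pre s.
Proof.
by move=> q0; elim: s pre => [|c s IH] pre /=; rewrite ?ler01 ?mulr_ge0.
Qed.

Lemma chainM q r pre s :
  chain (fun b c => q b c * r b c) pre s = chain q pre s * chain r pre s.
Proof.
by elim: s pre => [|c s IH] pre /=; rewrite ?mul1r // IH mulrACA.
Qed.

(** The tails sum to the same power of [M] whatever the first bit is, and the two first factors then
    add up to one more [M]. *)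
Lemma sum_chain n q M pre : (forall b, q b true + q b false = M) ->
  \sum_(x : n.-tuple bool) chain q pre x = M ^+ n.
Proof.
move=> qM; elim: n pre => [|n IH] pre.
  rewrite (eq_bigr (fun=> 1)) => [|x _]; last by rewrite tuple0.
  by rewrite sumr_const card_tuple expr0.
rewrite (reindex (fun ct : bool * n.-tuple bool => [tuple of ct.1 :: ct.2])) /=; last first.
  exists (fun x : n.+1.-tuple bool => (thead x, [tuple of behead x])).
    by case=> c t _; congr (_, _); apply/val_inj.
  by move=> x _; rewrite -tuple_eta.
rewrite -(pair_bigA _ (fun c (t : n.-tuple bool) => q pre c * chain q (rcons pre c) t)) /=.
by rewrite big_bool /= -!mulr_sumr !IH -mulrDl qM exprS.
Qed.

End Chain.

(** * Self-reducibility and the chain rule *)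

Section ChainRule.
Variables (R : realType) (n m : nat) (G : sr_sampler R n m).
Variable psi : m.-tuple bool.

Definition next_bit (b : seq bool) (c : bool) (y : n.-tuple bool) : bool :=
  nth false y (size b) == c.

Definition bit_prob (b : seq bool) (c : bool) : R :=
  freq G (SubCond G psi b) (next_bit b c).

(** Every sample has exactly one value at position [size b]; past the end this is the default of
    [nth], so the identity covers all [b], as [sum_chain] requires. *)
Lemma bit_prob_sum b : bit_prob b true + bit_prob b false = 1.
Proof.
rewrite /bit_prob /freq -big_split -[RHS](pmf_sum1 (sr_dist G (SubCond G psi b))).
apply: eq_bigr => y _; rewrite /next_bit.
by case: (nth _ _ _); rewrite /= mulr1 mulr0 ?addr0 ?add0r.
Qed.

Lemma subcube_rcons (b : seq bool) c (y : n.-tuple bool) : (size b < n)%N ->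
  (y \in subcube n (rcons b c)) = (y \in subcube n b) && next_bit b c y.
Proof.
move=> bn; rewrite !inE !prefixE size_rcons (take_nth false) ?size_tuple //.
by rewrite eqseq_rcons.
Qed.

Lemma Pr_rcons (b : seq bool) c : (size b < n)%N ->
  Pr (sr_dist G psi) (subcube n b) * bit_prob b c = Pr (sr_dist G psi) (subcube n (rcons b c)).
Proof.
move=> bn; have [P0|P0] := eqVneq (Pr (sr_dist G psi) (subcube n b)) 0.
  (* On a null prefix the uniform convention is harmless: the longer subcube lies in a null one, so
     both sides vanish. *)
  rewrite P0 mul0r; apply/esym/le_anti/andP; split; last first.
    by apply: sumr_ge0 => y _; apply: pmf_ge0.
  rewrite -P0 /Pr [leLHS]big_mkcond [leRHS]big_mkcond; apply: ler_sum => y _.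
  rewrite subcube_rcons //; case: (y \in subcube n b) => //=.
  by case: ifP => // _; apply: pmf_ge0.
rewrite /bit_prob /freq mulr_sumr [RHS]big_mkcond; apply: eq_bigr => y _.
rewrite SubCondP ?(ltnW bn) // /cond_subcube (negbTE P0) subcube_rcons //.
case: (y \in subcube n b); last by rewrite /= mul0r mulr0.
by case: (next_bit b c y); rewrite /= ?mulr0 // mulr1 mulrC divfK.
Qed.

Lemma Pr_chain (b s : seq bool) : (size b + size s <= n)%N ->
  Pr (sr_dist G psi) (subcube n b) * chain bit_prob b s = Pr (sr_dist G psi) (subcube n (b ++ s)).
Proof.
elim: s b => [|c s IH] b /=; first by rewrite mulr1 cats0.
rewrite addnS => h; rewrite mulrA Pr_rcons; last by rewrite (leq_trans _ h) // ltnS leq_addr.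
by rewrite IH ?size_rcons ?addSn // cat_rcons.
Qed.

Lemma pmf_chain (x : n.-tuple bool) : sr_dist G psi x = chain bit_prob [::] x.
Proof.
have := @Pr_chain [::] x; rewrite size_tuple add0n => /(_ (leqnn _)) /=.
have -> : Pr (sr_dist G psi) (subcube n [::]) = 1.
  rewrite /Pr (eq_bigl predT) ?pmf_sum1 // => y.
  by rewrite inE prefix0s.
rewrite mul1r => ->; rewrite /Pr (big_pred1 x) // => y.
by rewrite inE prefixE size_tuple take_oversize ?size_tuple.
Qed.

End ChainRule.

(** * Estimating the probability of a point *)

Section Estimate.
Variables (R : realType) (n m : nat) (psi : m.-tuple bool) (N : nat).

(** The prefixes are read off [s], not off the answers, and each uses fresh draws, so the factors
    are independent. *)
Fixpoint estimate (b s : seq bool) : prog n m R :=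
  if s is c :: s' then
    AskP psi b (fun phi => bind (hits phi (next_bit b c) N) (fun h =>
      bind (estimate (rcons b c) s') (fun r => Ret (h%:R / N%:R * r))))
  else Ret 1.

Lemma draws_estimate b s : (draws (estimate b s) <= size s * N)%N.
Proof.
elim: s b => //= c s IH b; apply/bigmax_leqP => phi _; rewrite mulSn.
apply: leq_trans (draws_bind _ (d := size s * N) _) _ => [h|].
  apply: leq_trans (draws_bind _ (d := 0) _) _ => //.
  by rewrite addn0.
by rewrite leq_add2r draws_hits.
Qed.

Variable G : sr_sampler R n m.
Hypothesis N_gt0 : (0 < N)%N.
Let q := bit_prob G psi.

Let N_neq0 : N%:R != 0 :> R. Proof. by rewrite pnatr_eq0 -lt0n. Qed.

Lemma expect_estimate b s : expect G (estimate b s) id = chain q b s.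
Proof.
elim: s b => //= c s IH b; rewrite expect_bind.
have step h : expect G (bind (estimate (rcons b c) s) (fun r => Ret (h%:R / N%:R * r)))
    id = N%:R^-1 * chain q (rcons b c) s * h%:R.
  by rewrite expect_bind /= expectZ IH; ring.
rewrite (eq_expect _ _ step) expectZ expect_hits -/(bit_prob G psi b c) -/q.
by field.
Qed.

(** Independence multiplies the second moments of the frequencies, each at most
    [p^2 + p/N = p (p + 1/N)]. The factors [p] are split off because they multiply to the point
    probability by which the chi-square error divides. *)
Lemma expect_estimate2 b s : expect G (estimate b s) (fun r => r ^+ 2)
  <= chain q b s * chain (fun b c => q b c + N%:R^-1) b s.
Proof.
rewrite -chainM; elim: s b => [|c s IH] b /=; first by rewrite expr1n.
rewrite expect_bind.
have step h : expect G (bind (estimate (rcons b c) s) (fun r => Ret (h%:R / N%:R * r)))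
    (fun r => r ^+ 2) = N%:R^-1 ^+ 2 * expect G (estimate (rcons b c) s)
      (fun r => r ^+ 2) * h%:R ^+ 2.
  rewrite expect_bind /= mulrAC -expectZ.
  by apply: eq_expect => r; ring.
rewrite (eq_expect _ _ step) expectZ [leLHS]mulrAC.
apply: ler_pM.
- rewrite mulr_ge0 ?sqr_ge0 // -(expect_cst G (hits (SubCond G psi b) (next_bit b c) N) 0).
  by apply: expect_le => h; apply: sqr_ge0.
- rewrite -(expect_cst G (estimate (rcons b c) s) 0).
  by apply: expect_le => h; apply: sqr_ge0.
- rewrite exprVn mulrC ler_pdivrMr ?exprn_gt0 ?ltr0n //.
  apply: le_trans (expect_hits2 _ _ _ _) _; rewrite -/(bit_prob G psi b c) -/q.
  by apply: eqr_le; field.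
- exact: IH.
Qed.

(** For a point of mass [P > 0], unbiasedness turns the term into [E[r^2] / P - P], at most the
    chain of [q + 1/N] minus [P]. The two values of [q + 1/N] at any prefix add up to [1 + 2/N], so
    [sum_chain] gives a bound free of [G]. *)
Lemma sum_chi2_estimate :
  \sum_(x : n.-tuple bool) sr_dist G psi x *
      expect G (estimate [::] x) (fun r => (r / sr_dist G psi x - 1) ^+ 2)
  <= (1 + 2 / N%:R) ^+ n - 1.
Proof.
rewrite -(@sum_chain _ n (fun b c => q b c + N%:R^-1) _ [::]); last first.
  by move=> b; rewrite addrACA bit_prob_sum; ring.
rewrite -[X in _ - X](pmf_sum1 (sr_dist G psi)) -sumrB; apply: ler_sum => x _.
set P := sr_dist G psi x; have PE : P = chain q [::] x by apply: pmf_chain.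
have q0 b c : 0 <= q b c by apply: freq_ge0.
have [P0|P0] := eqVneq P 0.
  rewrite P0 mul0r subr0; apply: chain_ge0 => b c.
  by rewrite addr_ge0 // invr_ge0.
have Pgt : 0 < P by rewrite lt_neqAle eq_sym P0 pmf_ge0.
have -> : expect G (estimate [::] x) (fun r => (r / P - 1) ^+ 2) =
   P^-1 ^+ 2 * expect G (estimate [::] x) (fun r => r ^+ 2) - 1.
  transitivity (expect G (estimate [::] x)
    (fun r => (P^-1 ^+ 2 * r ^+ 2 + (- (2 / P)) * r) + 1)).
    by apply: eq_expect => r; ring.
  by rewrite !expectD !expectZ expect_cst expect_estimate -PE; field.
rewrite mulrBr mulr1 lerD2r.
have := expect_estimate2 [::] x; rewrite -PE.
move=> h; rewrite -(ler_pM2l Pgt); apply: le_trans h.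
by apply: eqr_le; field.
Qed.

End Estimate.

(** * A bounded score, stable under relative error, and the distance it measures *)

Section Score.
Variable R : realType.

(** Clipping at 1 keeps the score in [[0, 1]] even for negative [r], as the Chernoff bound asks of
    every value. At [r = 0] the quotient is 0 and the score is 1. *)
Definition score (Q r : R) : R := Num.min 1 (Num.max 0 (1 - Q / r)).

Lemma score_itv Q r : 0 <= score Q r <= 1.
Proof. by rewrite /score le_min ler01 le_max lexx ge_min lexx. Qed.

(** For [r > 0] put [u = Q / r] and [rho = r / P], so that [Q / P = u rho]. If [u <= 1], the two
    scores differ by at most [u |rho - 1|]; if [u > 1], the first is 0 and the second at most
    [max(0, 1 - rho)]. *)
Lemma score_lipschitz (Q P r : R) : 0 <= Q -> 0 < P ->
  `|score Q r - Num.max 0 (1 - Q / P)| <= `|r / P - 1|.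
Proof.
move=> Q0 P0.
have QP0 : 0 <= Q / P by rewrite divr_ge0 // ltW.
have mP : 0 <= Num.max 0 (1 - Q / P) <= 1.
  by rewrite le_max lexx /= ge_max ler01 /= lerBlDr lerDl.
have := score_itv Q r.
(* For [r <= 0] the right side is at least 1 while both scores lie in [[0, 1]]; this also covers the
   division by zero. *)
have [r0|r0] := leP r 0.
  have rP : r / P <= 0 by rewrite pmulr_lle0 ?invr_gt0.
  move=> sc; rewrite [leRHS]ler0_norm; last by lra.
  by rewrite ler_norml; lra.
move=> _; set u := Q / r; set rho := r / P.
have -> : Q / P = u * rho by rewrite /u /rho; field; rewrite !gt_eqF.
have u0 : 0 <= u by rewrite divr_ge0 // ltW.
have rho0 : 0 < rho by rewrite divr_gt0.
rewrite /score -/u.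
have -> : Num.min 1 (Num.max 0 (1 - u)) = Num.max 0 (1 - u).
  by apply/min_idPr; rewrite ge_max ler01 /= lerBlDr lerDl.
have /ler_normlP [h1 h2] := lexx `|rho - 1|.
rewrite ler_norml.
have [hu|hu] := leP 0 (1 - u); have [hv|hv] := leP 0 (1 - u * rho).
- have : `|u * (rho - 1)| <= `|rho - 1|.
    by rewrite normrM ler_piMl // ger0_norm //; lra.
  by rewrite ler_norml; lra.
- have : `|u * (rho - 1)| <= `|rho - 1|.
    by rewrite normrM ler_piMl // ger0_norm //; lra.
  by rewrite ler_norml; lra.
- have : rho <= u * rho by rewrite ler_peMl //; lra.
  by lra.
- by have := normr_ge0 (rho - 1); lra.
Qed.

End Score.

(** The positive part dominates every summand, and the set where [W psi x <= G psi x] attains the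
    sum. *)
Lemma dTV_sum (R : realType) n m (G W : sampler R n m) psi :
  dTV G W psi = \sum_x Num.max 0 (G psi x - W psi x).
Proof.
apply/le_anti/andP; split.
  apply: bigmax_le => [|A _].
    by apply: sumr_ge0 => x _; rewrite le_max lexx.
  rewrite /Pr -sumrB [leLHS]big_mkcond; apply: ler_sum => x _.
  by case: ifP => _; rewrite le_max lexx ?orbT.
apply: (@bigmax_sup _ _ _ _ [set x | W psi x <= G psi x]) => //.
rewrite /Pr -sumrB [leRHS]big_mkcond; apply: ler_sum => x _.
rewrite inE; case: (leP (W psi x) (G psi x)) => h.
  by rewrite ge_max lexx subr_ge0 h.
by rewrite ge_max lexx subr_le0 ltW.
Qed.

(** * One trial and its bias *)

Section Trial.
Variables (R : realType) (n m : nat) (G W : sr_sampler R n m).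
Variables (psi : m.-tuple bool) (N : nat).

Definition trial : prog n m (n.-tuple bool * R) :=
  DrawP psi (fun x => bind (estimate R n psi N [::] x) (fun r => Ret (x, r))).

Definition trial_score (xr : n.-tuple bool * R) : R :=
  score (sr_dist W psi xr.1) xr.2.

Lemma draws_trial : (draws trial <= (n * N).+1)%N.
Proof.
rewrite /= ltnS; apply/bigmax_leqP => x _.
apply: leq_trans (draws_bind _ (d := 0) _) _ => //.
by rewrite addn0 (leq_trans (draws_estimate _ _ _ _ _ _)) // size_tuple.
Qed.

(* [u <= u^2/c + c/4] trades the L1 error of the likelihood ratio for its
   chi-square error, whose average over [x ~ G psi] is independent of [G]. *)
Lemma trial_bias (c : R) : (0 < N)%N -> 0 < c ->
  `|expect G trial trial_score - dTV G W psi|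
    <= ((1 + 2 / N%:R) ^+ n - 1) / c + c / 4.
Proof.
move=> N0 c0; rewrite dTV_sum /=.
rewrite -sumrB; apply: le_trans (ler_norm_sum _ _ _) _.
pose e (x : n.-tuple bool) := expect G (estimate R n psi N [::] x)
  (fun r => (r / sr_dist G psi x - 1) ^+ 2).
apply: (@le_trans _ _ (\sum_x sr_dist G psi x * (c^-1 * e x + c / 4))).
  apply: ler_sum => x _; set P := sr_dist G psi x; set Q := sr_dist W psi x.
  have Q0 : 0 <= Q by apply: pmf_ge0.
  have [P0|P0] := eqVneq P 0.
    by rewrite P0 !mul0r !sub0r (max_idPl _) ?oppr_le0 // oppr0 normr0.
  have Pgt : 0 < P by rewrite lt_neqAle eq_sym P0 pmf_ge0.
  have -> : Num.max 0 (P - Q) = P * Num.max 0 (1 - Q / P).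
    by rewrite maxr_pMr ?ltW // mulr0 mulrBr mulr1 mulrCA divff // mulr1.
  rewrite -mulrBr normrM gtr0_norm // ler_pM2l //.
  rewrite expect_bind; apply: expect_dist.
  rewrite -expectZ -[c / 4](expect_cst G (estimate R n psi N [::] x)) -expectD.
  apply: expect_le => r /=; rewrite /trial_score /= -/Q.
  apply: le_trans (score_lipschitz r Q0 Pgt) _; rewrite -/P.
  rewrite -real_normK ?num_real //; set u := `|_|.
  have -> : c^-1 * u ^+ 2 + c / 4 = u + c^-1 * (u - c / 2) ^+ 2.
    by field; rewrite gt_eqF.
  by rewrite lerDl mulr_ge0 ?sqr_ge0 // invr_ge0 ltW.
under eq_bigr do rewrite mulrDr mulrCA.
rewrite big_split /= -mulr_sumr -mulr_suml pmf_sum1 mul1r lerD2r mulrC.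
by rewrite ler_pM2r ?invr_gt0 // sum_chi2_estimate.
Qed.

End Trial.

(** * A Chernoff bound for sums of independent bounded scores *)

Section Chernoff.
Variables (R : realType) (n m : nat) (A : Type).
Variables (p : prog n m A) (f : A -> R).

Fixpoint total (t : nat) : prog n m R :=
  if t is t'.+1 then
    bind p (fun a => bind (total t') (fun S => Ret (f a + S)))
  else Ret 0.

Lemma draws_total t : (draws (total t) <= t * draws p)%N.
Proof.
elim: t => //= t IH; rewrite mulSn; apply: draws_bind => a.
apply: leq_trans (draws_bind _ (d := 0) _) _ => //.
by rewrite addn0.
Qed.

Variable G : sr_sampler R n m.
Hypothesis f_itv : forall a, 0 <= f a <= 1.
Let mu := expect G p f.

Lemma mean_itv : 0 <= mu <= 1.
Proof.
apply/andP; split; [rewrite -[leLHS](expect_cst G p 0) |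
  rewrite -[leRHS](expect_cst G p 1)];
  by apply: expect_le => a; have /andP[] := f_itv a.
Qed.

(** Multiply by [1 - u > 0]: the left side is at most 1 because [1 - u <= expR (- u)], and the right
    side is [1 + u^2 (1 - 2 u) >= 1]. *)
Lemma expR_le_quadratic (u : R) : u <= 2^-1 -> expR u <= 1 + u + 2 * u ^+ 2.
Proof.
move=> u2; have := expR_ge1Dx (- u); rewrite expRN => h.
have e0 := expR_gt0 u.
have h' : expR u * (1 - u) <= 1.
  by rewrite -ler_pdivlMl // mulr1.
rewrite -(@ler_pM2r _ (1 - u)); last by lra.
apply: le_trans h' _.
have -> : (1 + u + 2 * u ^+ 2) * (1 - u) = 1 + u ^+ 2 * (1 - 2 * u) by ring.
by rewrite lerDl mulr_ge0 ?sqr_ge0 //; lra.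
Qed.

Lemma mgf_single (s : R) : `|s| <= 2^-1 ->
  expect G p (fun a => expR (s * (f a - mu))) <= expR (2 * s ^+ 2).
Proof.
move=> s2; have mu01 := mean_itv.
(* The bound is affine in [f a], so taking expectations cancels [s * mu] and leaves [1 + 2 s^2]. *)
have bnd a : expR (s * (f a - mu)) <= (1 + 2 * s ^+ 2 - s * mu) + s * f a.
  have fa := f_itv a.
  have d1 : `|f a - mu| <= 1 by rewrite ler_norml; lra.
  have sd : s * (f a - mu) <= 2^-1.
    apply: le_trans (ler_norm _) _; rewrite normrM.
    by apply: le_trans s2; rewrite ler_piMr.
  apply: le_trans (expR_le_quadratic sd) _.
  suff : (s * (f a - mu)) ^+ 2 <= s ^+ 2 by lra.
  by rewrite exprMn ler_piMr ?sqr_ge0 // -real_normK ?num_real // expr_le1.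
apply: le_trans (expect_le _ _ bnd) _; rewrite expectD expect_cst expectZ -/mu.
by rewrite subrK expR_ge1Dx.
Qed.

Lemma mgf_total (s : R) t : `|s| <= 2^-1 ->
  expect G (total t) (fun S => expR (s * (S - t%:R * mu)))
    <= expR (2 * s ^+ 2) ^+ t.
Proof.
move=> s2; elim: t => [|t IH] /=; first by rewrite mul0r subrr mulr0 expR0.
rewrite expect_bind exprSr.
apply: (@le_trans _ _ (expect G p (fun a => expR (2 * s ^+ 2) ^+ t *
    expR (s * (f a - mu))))); last first.
  by rewrite expectZ ler_wpM2l ?mgf_single // exprn_ge0 // expR_ge0.
apply: expect_le => a; rewrite expect_bind /= [leRHS]mulrC.
apply: (@le_trans _ _ (expR (s * (f a - mu)) *
   expect G (total t) (fun S => expR (s * (S - t%:R * mu))))).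
  rewrite -expectZ; apply: expect_le => S; rewrite -expRD -natr1.
  by apply: eqr_le; congr expR; ring.
by rewrite ler_wpM2l // expR_ge0.
Qed.

(** Markov's inequality for the exponential moment; the sign of [s] selects the upper or the lower
    tail. For a deviation [theta] per trial, [|s| = theta / 4] minimizes [2 s^2 - |s| theta], with
    value [- theta^2 / 8]; [theta <= 2] keeps [|s| <= 1/2]. *)
Lemma tail_total (s theta : R) t (a : pred R) :
  0 <= theta <= 2 -> `|s| = theta / 4 ->
  (forall S, a S -> theta ^+ 2 * t%:R / 4 <= s * (S - t%:R * mu)) ->
  expect G (total t) (fun S => (a S)%:R) <= expR (- (t%:R * theta ^+ 2 / 8)).
Proof.
move=> th sE aP.
have bnd S : (a S)%:R <= expR (- (theta ^+ 2 * t%:R / 4)) * expR (s * (S - t%:R * mu)).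
  rewrite -expRD; case: (boolP (a S)) => [/aP h|_]; last exact: expR_ge0.
  by rewrite /=; apply: le_trans (expR_ge1Dx _); lra.
apply: le_trans (expect_le _ _ bnd) _; rewrite expectZ.
have s2 : `|s| <= 2^-1 by rewrite sE; lra.
apply: le_trans (ler_wpM2l (expR_ge0 _) (mgf_total t s2)) _.
rewrite -expRM_natl -expRD; apply: eqr_le; congr expR.
by rewrite -(real_normK (num_real s)) sE; field.
Qed.

End Chernoff.

(** By induction each factor adds at most [4/N]: [2/N] directly, and [2/N] for the cross term since
    [4 n / N <= 1]. *)
Lemma bernoulli_upper (R : realType) (n : nat) (N : R) : 0 < N -> 4 * n%:R <= N ->
  (1 + 2 / N) ^+ n - 1 <= 4 * n%:R / N.
Proof.
move=> N0 nN; have iN : 0 < N^-1 by rewrite invr_gt0.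
rewrite lerBlDl; elim: n nN => [|n IH] nN.
  by rewrite expr0 mulr0 mul0r addr0.
have nN' : 4 * n%:R <= N by apply: le_trans nN; rewrite ler_pM2l // ler_nat.
rewrite exprSr.
have st : 0 <= 1 + 2 / N by rewrite addr_ge0 // mulr_ge0 // ltW.
apply: le_trans (ler_wpM2r st (IH nN')) _.
have -> : (1 + 4 * n%:R / N) * (1 + 2 / N) =
  1 + 4 * n%:R / N + 2 / N + 4 * n%:R / N * (2 / N) by ring.
have h1 : 4 * n%:R / N <= 1 by rewrite ler_pdivrMr // mul1r.
have : 4 * n%:R / N * (2 / N) <= 2 / N by rewrite ler_piMl // mulr_ge0 // ltW.
by rewrite -natr1; lra.
Qed.

(** * The tester, its correctness and its sample count *)

Section Tester.
Variables (R : realType) (n m : nat).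

Definition probes (gam : R) : nat := (Num.truncn (64 * n%:R / gam ^+ 2)).+1.

(** The constant is [8 * 4^2]: a deviation [theta = gam / 4] gives the exponent [t gam^2 / 128]. *)
Definition trials (gam delta : R) : nat :=
  (Num.truncn (128 * ln delta^-1 / gam ^+ 2)).+1.

(** The midpoint threshold is [gam / 2] away from both [eps] and [eta], where [gam = eta - eps]:
    half of this absorbs the bias, half the random deviation. *)
Definition cube_probe (eps eta delta : R) (W : sr_sampler R n m)
    (psi : m.-tuple bool) : prog n m verdict :=
  let t := trials (eta - eps) delta in
  bind (total (trial R n psi (probes (eta - eps))) (trial_score W psi) t)
    (fun S => Ret (if S <= t%:R * ((eps + eta) / 2) then ACCEPT else REJECT)).

(** At [n = 0] the claimed sample bound is 0, so the answer must come without any draw. *)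
Definition cube_probe_tester (eps eta delta : R) : tester R n m :=
  fun W psi =>
    if n == 0%N then Output n m ACCEPT else compile (cube_probe eps eta delta W psi).

Lemma probes_ge gam : 64 * n%:R / gam ^+ 2 <= (probes gam)%:R.
Proof. exact/ltW/truncnS_gt. Qed.

Lemma probes_le gam : (probes gam)%:R <= 64 * n%:R / gam ^+ 2 + 1.
Proof. by rewrite -[leLHS]natr1 lerD2r truncn_le divr_ge0 ?sqr_ge0 // mulr_ge0. Qed.

Lemma trials_ge gam delta : 128 * ln delta^-1 / gam ^+ 2 <= (trials gam delta)%:R.
Proof. exact/ltW/truncnS_gt. Qed.

Lemma trials_le gam delta : 0 < delta < 1 ->
  (trials gam delta)%:R <= 128 * ln delta^-1 / gam ^+ 2 + 1.
Proof.
move=> /andP[d0 d1]; rewrite -[leLHS]natr1 lerD2r truncn_le divr_ge0 ?sqr_ge0 //.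
by rewrite mulr_ge0 // ln_ge0 // invf_ge1 // ltW.
Qed.

(** With [c = gam / 2] both terms of [trial_bias] are at most [gam / 8]: the number of probes makes
    the chi-square error at most [4 n / N <= gam^2 / 16]. *)
Lemma bias_le_quarter (G W : sr_sampler R n m) psi gam : 0 < gam < 1 ->
  `|expect G (trial R n psi (probes gam)) (trial_score W psi) - dTV G W psi|
    <= gam / 4.
Proof.
move=> gam01; have c0 : 0 < gam / 2 by lra.
have gam_gt0 : 0 < gam by lra.
have gam2_gt0 : 0 < gam ^+ 2 by rewrite exprn_gt0.
have gam2_le1 : gam ^+ 2 <= 1 by rewrite expr_le1 //; lra.
apply: le_trans (trial_bias G W psi (isT : (0 < probes gam)%N) c0) _.
have N0 : 0 < (probes gam)%:R :> R by rewrite ltr0n.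
have h64 : 64 * n%:R <= (probes gam)%:R * gam ^+ 2.
  by rewrite -ler_pdivrMr // probes_ge.
have h4 : 4 * n%:R <= (probes gam)%:R :> R.
  have : (probes gam)%:R * gam ^+ 2 <= (probes gam)%:R by rewrite ler_piMr // ltW.
  by have := ler0n R n; lra.
have h := bernoulli_upper N0 h4.
have h8 : 4 * n%:R / (probes gam)%:R <= gam ^+ 2 / 16.
  by rewrite ler_pdivrMr //; lra.
have : ((1 + 2 / (probes gam)%:R) ^+ n - 1) / (gam / 2) <= gam / 8.
  rewrite ler_pdivrMr //; apply: le_trans h _; apply: le_trans h8 _.
  by apply: eqr_le; field.
by lra.
Qed.

Lemma tail_le_delta gam delta : 0 < gam -> 0 < delta ->
  expR (- ((trials gam delta)%:R * (gam / 4) ^+ 2 / 8)) <= delta.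
Proof.
move=> gam_gt0 d0; have gam2_gt0 : 0 < gam ^+ 2 by rewrite exprn_gt0.
rewrite -[leRHS](@lnK _ delta) // ler_expR.
have := trials_ge gam delta; rewrite lnV // ler_pdivrMr //.
have -> : (trials gam delta)%:R * (gam / 4) ^+ 2 / 8 =
  (trials gam delta)%:R * gam ^+ 2 / 128 by field.
lra.
Qed.

Lemma identity_cube_probe_tester (eps eta delta : R) :
  0 < eps < 1 -> 0 < eta < 1 -> eps < eta -> 0 < delta < 1 ->
  identity_tester eps eta delta (cube_probe_tester eps eta delta).
Proof.
move=> eps01 eta01 lt_eps_eta delta01 G W psi; have d0 : 0 < delta by lra.
pose gam := eta - eps.
have gam01 : 0 < gam < 1 by rewrite /gam; lra.
have gam_gt0 : 0 < gam by lra.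
rewrite /close /far /cube_probe_tester.
(* There is a single string of length 0, so the distance is 0 and the far case contradicts
   [eta > 0]. *)
have [n0|n_neq0] := eqVneq n 0%N.
  split=> [_|]; first by rewrite /=; lra.
  suff -> : dTV G W psi = 0 by move=> ?; lra.
  rewrite dTV_sum big1 // => x _.
  have one (D : fdist R (n.-tuple bool)) : D x = 1.
    rewrite -(pmf_sum1 D) (big_pred1 x) // => y.
    by apply/esym/eqP/val_inj; case: x y; rewrite n0 => [[|? ?] //= _ [[|? ?]]].
  by rewrite !one subrr maxxx.
set t := trials gam delta.
set p := trial R n psi (probes gam); set f := trial_score W psi.
have fI a : 0 <= f a <= 1 by apply: score_itv.
have t0 : 0 <= t%:R :> R by [].
have th : 0 <= gam / 4 <= 2 by lra.
have bias := bias_le_quarter G W psi gam01; rewrite -/p -/f ler_norml in bias.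
have probE v : prob_output G v (compile (cube_probe eps eta delta W psi)) =
    expect G (total p f t) (fun S => (verdict_eqb
      (if S <= t%:R * ((eps + eta) / 2) then ACCEPT else REJECT) v)%:R).
  by rewrite prob_output_compile expect_bind.
(* Here [a] is the failure event: outside it the output is [v]. *)
have wrap (a : pred R) v :
    (forall S, ~~ a S -> verdict_eqb (if S <= t%:R * ((eps + eta) / 2)
      then ACCEPT else REJECT) v) ->
    expect G (total p f t) (fun S => (a S)%:R) <= delta ->
    1 - delta <= prob_output G v (compile (cube_probe eps eta delta W psi)).
  move=> aP ha; rewrite probE; apply: (@le_trans _ _ (expect G (total p f t)
    (fun S => 1 + (-1) * (a S)%:R))).
    by rewrite expectD expect_cst expectZ; lra.
  apply: expect_le => S; have := aP S; case: (a S) => /=.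
    by move=> _; rewrite mulr1 subrr.
  by move=> -> //; rewrite mulr0 addr0.
split=> h.
- apply: (wrap (fun S => t%:R * ((eps + eta) / 2) < S)) => [S|].
    by rewrite -leNgt => ->.
  apply: le_trans (tail_le_delta gam_gt0 d0).
  apply: (tail_total fI th (s := gam / 4 / 4)) => [|S hS].
    by rewrite ger0_norm //; lra.
  set mu := expect G p f in bias *.
  have : t%:R * mu <= t%:R * ((eps + eta) / 2 - gam / 4).
    by apply: ler_wpM2l => //; rewrite /gam in bias *; lra.
  move=> h1; have h2 : t%:R * (gam / 4) <= S - t%:R * mu by lra.
  have g16 : 0 <= gam / 4 / 4 by lra.
  by have := ler_wpM2l g16 h2; lra.
- apply: (wrap (fun S => S <= t%:R * ((eps + eta) / 2))) => [S|].
    by move=> /negbTE ->.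
  apply: le_trans (tail_le_delta gam_gt0 d0).
  (* Rejection fails on the lower tail, hence the negative [s]. *)
  apply: (tail_total fI th (s := - (gam / 4 / 4))) => [|S hS].
    by rewrite normrN ger0_norm //; lra.
  set mu := expect G p f in bias *.
  have : t%:R * ((eps + eta) / 2 + gam / 4) <= t%:R * mu.
    by apply: ler_wpM2l => //; rewrite /gam in bias *; lra.
  move=> h1; have h2 : t%:R * (gam / 4) <= t%:R * mu - S by lra.
  have g16 : 0 <= gam / 4 / 4 by lra.
  by have := ler_wpM2l g16 h2; lra.
Qed.

Lemma draws_cube_probe (W : sr_sampler R n m) psi (eps eta delta : R) :
  (draws (cube_probe eps eta delta W psi)
    <= trials (eta - eps) delta * (n * probes (eta - eps)).+1)%N.
Proof.
apply: leq_trans (draws_bind _ (d := 0) _) _ => //.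
rewrite addn0; apply: leq_trans (draws_total _ _ _) _.
by rewrite leq_mul2l draws_trial orbT.
Qed.

(** The constant is [130 * 66]. Rounding up the number of trials costs 1, at most [2 L / gam^2]
    since [L >= 1/2]; the roundings in the draws per trial are absorbed using [n >= 1] and
    [gam <= 1]. *)
Lemma num_samples_cube_probe_tester (W : sr_sampler R n m) psi (eps eta delta : R) :
  0 < eta - eps < 1 -> 0 < delta < 1 ->
  (num_samples (cube_probe_tester eps eta delta W psi))%:R
    <= 8580 * (n%:R ^+ 2 / (eta - eps) ^+ 4)
         * ln (2 + n%:R / ((eta - eps) * delta)).
Proof.
set gam := eta - eps => gam01 delta01; have gam_gt0 : 0 < gam by lra.
have gam2_gt0 : 0 < gam ^+ 2 by rewrite exprn_gt0.
have gam2_le1 : gam ^+ 2 <= 1 by rewrite expr_le1 //; lra.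
rewrite /cube_probe_tester; have [n0|n_neq0] := eqVneq n 0%N.
  by rewrite n0 expr0n /= mul0r mulr0 mul0r.
rewrite num_samples_compile.
have n1 : 1 <= n%:R :> R by rewrite ler1n lt0n.
set L := ln _.
have d0 : 0 < delta by lra.
have gd0 : 0 < gam * delta by rewrite mulr_gt0.
have lnL : ln delta^-1 <= L.
  have pos : 0 < 2 + n%:R / (gam * delta).
    by rewrite addr_gt0 // divr_gt0 //; lra.
  rewrite ler_ln ?posrE ?invr_gt0 //.
  have : delta^-1 <= n%:R / (gam * delta).
    rewrite ler_pdivlMr // mulrCA mulVf ?gt_eqF // mulr1.
    by lra.
  by lra.
have L_ge : 2^-1 <= L.
  have h2 : 2 <= 2 + n%:R / (gam * delta) by rewrite lerDl divr_ge0 // ltW.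
  have : ln 2 <= L by rewrite ler_ln ?posrE //; lra.
  (* [1 - ln 2 <= expR (- ln 2) = 1/2] gives [ln 2 >= 1/2]. *)
  have := @expR_ge1Dx R (- ln 2); rewrite expRN lnK ?posrE //.
  by lra.
have tB : (trials gam delta)%:R <= 130 * L / gam ^+ 2.
  apply: le_trans (trials_le _ delta01) _; rewrite ler_pdivlMr // mulrDl divfK ?gt_eqF //.
  by lra.
have NB : (n * probes gam).+1%:R <= 66 * n%:R ^+ 2 / gam ^+ 2.
  rewrite -natr1 natrM ler_pdivlMr // mulrDl mul1r -mulrA.
  have h := probes_le gam.
  have h1 : (probes gam)%:R * gam ^+ 2 <= 65 * n%:R.
    apply: le_trans (ler_wpM2r (ltW gam2_gt0) h) _.
    by rewrite mulrDl divfK ?gt_eqF //; lra.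
  have := ler_wpM2l (ler0n R n) h1.
  have : 1 <= n%:R ^+ 2 :> R by rewrite expr_ge1.
  by lra.
apply: (@le_trans _ _ ((trials gam delta)%:R * (n * probes gam).+1%:R)).
  by rewrite -natrM ler_nat draws_cube_probe.
apply: le_trans (ler_pM _ _ tB NB) _ => //.
by apply: eqr_le; field; rewrite gt_eqF.
Qed.

End Tester.

Theorem theorem3 (R : realType) :
  exists (T : forall (n m : nat) (eps eta delta : R), tester R n m)
         (C : R) (k : nat),
    forall (n m : nat) (eps eta delta : R),
      0 < eps < 1 -> 0 < eta < 1 -> eps < eta -> 0 < delta < 1 ->
      identity_tester eps eta delta (T n m eps eta delta) /\
      forall (W : sr_sampler R n m) (psi : m.-tuple bool),
        (num_samples (T n m eps eta delta W psi))%:R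
          <= C * (n%:R ^+ 2 / (eta - eps) ^+ 4)
               * ln (2 + n%:R / ((eta - eps) * delta)) ^+ k.
Proof.
exists (fun n m => @cube_probe_tester R n m), 8580, 1%N.
move=> n m eps eta delta heps heta hlt hdelta; split.
  exact: identity_cube_probe_tester.
by move=> W psi; rewrite expr1; apply: num_samples_cube_probe_tester => //; lra.
Qed.
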